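(* Let $n\ge1$, let $H\in\mathbb{R}^{n\times n}$ be symmetric positive definite with symmetric positive-definite square root $H^{1/2}$, $\delta>0$, $b\in\mathbb{R}^n$ with $\beta=\sqrt{b^{\mathsf T}H^{-1}b}>0$, and let $C_{\delta,H}=\{(t,z)\in\mathbb{R}\times\mathbb{R}^n: t\ge\sqrt{\delta^2+z^{\mathsf T}Hz}\}$, $\ell_0(t,z)=\beta t+b^{\mathsf T}z$, and $u=H^{-1/2}b/\beta$. For $\varepsilon>0$ consider $$(\mathsf T_\varepsilon)\qquad\min_{(t,z)\in C_{\delta,H}}\left\{\ell_0(t,z)+\frac{\varepsilon}{2}\bigl(t^2+z^{\mathsf T}Hz\bigr)\right\}.$$ For every $\varepsilon>0$, problem $(\mathsf T_\varepsilon)$ has a unique minimizer $(t_\varepsilon,z_\varepsilon)$. There is a unique $s_\varepsilon>0$ satisfying $$\beta\left(\frac{s_\varepsilon}{\sqrt{\delta^2+s_\varepsilon^2}}-1\right)+2\varepsilon s_\varepsilon=0,$$ and $t_\varepsilon=\sqrt{\delta^2+s_\varepsilon^2}$, $z_\varepsilon=-s_\varepsilon H^{-1/2}u$. As $\varepsilon\downarrow0$, $$s_\varepsilon\sim\left(\frac{\beta\delta^2}{4\varepsilon}\right)^{1/3},$$ $$\ell_0(t_\varepsilon,z_\varepsilon)\sim2^{-1/3}(\beta\delta^2)^{2/3}\varepsilon^{1/3},$$ $$\frac{\varepsilon}{2}\bigl(t_\varepsilon^2+z_\varepsilon^{\mathsf T}Hz_\varepsilon\bigr)\sim2^{-4/3}(\beta\delta^2)^{2/3}\varepsilon^{1/3},$$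 $$\operatorname{val}(\mathsf T_\varepsilon)\sim3\cdot2^{-4/3}(\beta\delta^2)^{2/3}\varepsilon^{1/3}.$$ In particular, the regularized minimizers escape to infinity at rate $\varepsilon^{-1/3}$.
   Context: $\operatorname{val}$ denotes the optimal value. $A\sim B$ means $A/B\to1$ as $\varepsilon\downarrow0$. *)

(* Defs.v *)
From mathcomp Require Import all_boot all_order all_algebra.
From mathcomp Require Import all_classical all_reals all_analysis.

Set Implicit Arguments.
Unset Strict Implicit.
Unset Printing Implicit Defensive.

Import Order.TTheory GRing.Theory Num.Theory.
Import numFieldNormedType.Exports.

Local Open Scope classical_set_scope.
Local Open Scope ring_scope.

Definition dotv (R : realType) (n : nat) (x y : 'cV[R]_n) : R :=
  (x^T *m y) 0 0.

Definition qform (R : realType) (n : nat) (A : 'M[R]_n) (x : 'cV[R]_n) : R :=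
  (x^T *m A *m x) 0 0.

Definition sym_posdef (R : realType) (n : nat) (A : 'M[R]_n) : Prop :=
  A^T = A /\ forall x : 'cV[R]_n, x != 0 -> 0 < qform A x.

Definition cone_set (R : realType) (n : nat) (delta : R) (H : 'M[R]_n) :
    set (R * 'cV[R]_n) :=
  [set p | Num.sqrt (delta ^+ 2 + qform H p.2) <= p.1].

Definition ell0 (R : realType) (n : nat) (beta : R) (b : 'cV[R]_n)
    (p : R * 'cV[R]_n) : R :=
  beta * p.1 + dotv b p.2.

Definition reg (R : realType) (n : nat) (H : 'M[R]_n) (eps : R)
    (p : R * 'cV[R]_n) : R :=
  eps / 2 * (p.1 ^+ 2 + qform H p.2).

Definition objT (R : realType) (n : nat) (H : 'M[R]_n) (beta : R)
    (b : 'cV[R]_n) (eps : R) (p : R * 'cV[R]_n) : R :=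
  ell0 beta b p + reg H eps p.

Definition minimizer (R : realType) (T : Type) (A : set T) (f : T -> R)
    (x : T) : Prop :=
  A x /\ forall y, A y -> f x <= f y.

(* [inf] is the real infimum; it is the junk value 0 if [f @` A] is empty or
   unbounded below, which does not happen when a minimizer exists. *)
Definition optval (R : realType) (T : Type) (A : set T) (f : T -> R) : R :=
  inf (f @` A).

(* Not the library's [~_F], which is defined through little-o. *)
Definition asymp (R : realType) (f g : R -> R) : Prop :=
  f x / g x @[x --> 0^'+] --> (1 : R).

(* Euclidean norm on R x R^n; the library norm on this product type is the
   sup norm. *)
Definition enorm (R : realType) (n : nat) (p : R * 'cV[R]_n) : R :=
  Num.sqrt (p.1 ^+ 2 + dotv p.2 p.2).

(* Main.v *)
(** With [w := H^(1/2) z] the problem reads: minimize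
    [beta (t + u.w) + eps/2 (t^2 + |w|^2)] over [t >= sqrt (delta^2 + |w|^2)],
    where [|u| = 1].  Let [s] solve the scalar equation and put
    [T := sqrt (delta^2 + s^2)].  The excess of the objective over its value at
    [(T, - s u)] is exactly
    [(beta + eps T) / T * (T t + s u.w - delta^2)
       + eps/2 ((t - T)^2 + |w + s u|^2)],
    and the first bracket is nonnegative by Cauchy-Schwarz, so [(T, - s u)] is the
    unique minimizer; uniqueness of [s] follows from that of the minimizer.

    For the asymptotics put [x := T / s].  The scalar equation is equivalent to
    [beta delta^2 = 2 eps s T (T + s) = 4 eps s^3 r^3] with [r^3 = x (x + 1) / 2],
    hence every quotient in the statement is an explicit function of [x] and [r],
    and it suffices that [x] tends to 1: with [y := s / T],
    [1 - y = 2 eps s / beta] and [(1 - y) (1 + y) = delta^2 / T^2] give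
    [(1 - y)^2 <= 2 eps delta / beta]. *)
Require Import Defs.
From mathcomp Require Import all_boot all_order all_algebra.
From mathcomp Require Import all_classical all_reals all_analysis.
From mathcomp Require Import ring lra.
Import Order.TTheory GRing.Theory Num.Theory.
Import numFieldNormedType.Exports.
Local Open Scope classical_set_scope.
Local Open Scope ring_scope.

(** * Euclidean dot product and quadratic forms *)

Section dot_product.
Context {R : realType} {n : nat}.
Implicit Types (x y : 'cV[R]_n) (A : 'M[R]_n).

Lemma dotvE x y : dotv x y = \sum_i x i 0 * y i 0.
Proof. by rewrite /dotv mxE; apply: eq_bigr => i _; rewrite mxE. Qed.

Lemma dotvC x y : dotv x y = dotv y x.
Proof. by rewrite !dotvE; apply: eq_bigr => i _; rewrite mulrC. Qed.

Lemma dotvDl x1 x2 y : dotv (x1 + x2) y = dotv x1 y + dotv x2 y.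
Proof. by rewrite /dotv linearD /= mulmxDl mxE. Qed.

Lemma dotvZl k x y : dotv (k *: x) y = k * dotv x y.
Proof. by rewrite /dotv linearZ /= -scalemxAl mxE. Qed.

Lemma dotvDr x y1 y2 : dotv x (y1 + y2) = dotv x y1 + dotv x y2.
Proof. by rewrite ![dotv x _]dotvC dotvDl. Qed.

Lemma dotvZr k x y : dotv x (k *: y) = k * dotv x y.
Proof. by rewrite ![dotv x _]dotvC dotvZl. Qed.

Lemma dotv_ge0 x : 0 <= dotv x x.
Proof. by rewrite dotvE sumr_ge0 // => i _; rewrite -expr2 sqr_ge0. Qed.

Lemma dotv_eq0 x : dotv x x = 0 -> x = 0.
Proof.
rewrite dotvE => /eqP; rewrite psumr_eq0; last first.
  by move=> i _; rewrite -expr2 sqr_ge0.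
move=> /allP x0; apply/matrixP => i j; rewrite ord1 mxE.
by have := x0 i (mem_index_enum i); rewrite -expr2 sqrf_eq0 => /eqP.
Qed.

(** Cauchy-Schwarz against a unit vector: expand the squared norm of the component of [y] orthogonal
    to [x]. *)
Lemma dotv_unit_le x y : dotv x x = 1 -> dotv x y ^+ 2 <= dotv y y.
Proof.
move=> x1; have := dotv_ge0 (y + - dotv x y *: x).
rewrite !dotvDl !dotvDr !dotvZl !dotvZr x1 [dotv y x]dotvC; lra.
Qed.

Lemma dotv_mulmx_sym A x y : A^T = A -> dotv (A *m x) y = dotv x (A *m y).
Proof. by move=> At; rewrite /dotv trmx_mul At mulmxA. Qed.

Lemma qform_sqr A x : A^T = A -> qform (A *m A) x = dotv (A *m x) (A *m x).
Proof. by move=> At; rewrite /qform /dotv trmx_mul At !mulmxA. Qed.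

Lemma sym_posdef_unitmx A : sym_posdef A -> A \in unitmx.
Proof.
move=> [At Apos]; rewrite -row_free_unit -kermx_eq0; apply/rowV0P => v.
move/sub_kermxP => vA0; apply/eqP; apply: contraT => v0.
have : 0 < qform A v^T by apply: Apos; rewrite trmx_eq0.
by rewrite /qform trmxK vA0 mul0mx mxE ltxx.
Qed.

End dot_product.

Lemma sqrt_sqrD_gt0 (R : realType) (delta s : R) :
  0 < delta -> 0 < Num.sqrt (delta ^+ 2 + s ^+ 2).
Proof. by move=> d0; rewrite sqrtr_gt0 ltr_pwDl ?sqr_ge0 ?exprn_gt0. Qed.

Lemma sqr_sqrt_sqrD (R : realType) (x y : R) :
  Num.sqrt (x ^+ 2 + y ^+ 2) ^+ 2 = x ^+ 2 + y ^+ 2.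
Proof. by rewrite sqr_sqrtr // addr_ge0 ?sqr_ge0. Qed.

Lemma minimizer_optval (R : realType) (T : Type) (A : set T) (f : T -> R) x :
  minimizer A f x -> optval A f = f x.
Proof.
move=> [Ax fx]; apply/eqP; rewrite eq_le; apply/andP; split.
  by apply: ge_inf; [exists (f x) => _ [y Ay <-]; exact: fx | exists x].
by apply: lb_le_inf; [exists (f x), x | move=> _ [y Ay <-]; exact: fx].
Qed.

(** * The scalar equation and real inequalities *)

Section stationary.
Context {R : realType}.
Implicit Types delta beta eps s : R.

(** The left-hand side is the derivative in [s] of the objective along the boundary curve
    [(sqrt (delta^2 + s^2), - s u)] in the coordinates [(t, w)]. *)
Definition stationary delta beta eps s : Prop :=
  0 < s /\
  beta * (s / Num.sqrt (delta ^+ 2 + s ^+ 2) - 1) + 2 * eps * s = 0.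

Lemma stationary_exists delta beta eps : 0 < delta -> 0 < beta -> 0 < eps ->
  exists s, stationary delta beta eps s.
Proof.
move=> d0 b0 e0.
pose f s := beta * (s / Num.sqrt (delta ^+ 2 + s ^+ 2) - 1) + 2 * eps * s.
(* At this right endpoint the linear term equals [beta] and cancels the [- beta], so that [f] is
   positive there. *)
have m0 : 0 < beta / (2 * eps) by rewrite divr_gt0 ?mulr_gt0.
have f0 : f 0 < 0 by rewrite /f mul0r mulr0 addr0 sub0r mulrN1 oppr_lt0.
have fm : 0 < f (beta / (2 * eps)).
  rewrite /f [X in _ + X](_ : _ = beta); last by field; lra.
  rewrite mulrBr mulr1 subrK mulr_gt0 // divr_gt0 //; exact: sqrt_sqrD_gt0.
have fc : continuous f.
  move=> x; rewrite /f.
  have sx : Num.sqrt (delta ^+ 2 + x ^+ 2) != 0 by rewrite gt_eqF ?sqrt_sqrD_gt0.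
  apply: cvgD; last by apply: cvgM; [exact: cvg_cst | exact: cvg_id].
  apply: cvgM; first exact: cvg_cst.
  apply: cvgB; last exact: cvg_cst.
  apply: cvgM; first exact: cvg_id.
  apply: cvgV => //.
  apply: (cvg_comp (fun y : R => delta ^+ 2 + y ^+ 2) Num.sqrt); last first.
    exact: sqrt_continuous.
  apply: cvgD; first exact: cvg_cst.
  exact: exprn_continuous.
have [//||s sI fs] := @IVT _ f 0 (beta / (2 * eps)) 0 (ltW m0).
- exact: continuous_subspaceT.
- by rewrite ge_min le_max (ltW f0) (ltW fm) orbT.
(* The root given on the closed interval is not the left endpoint, because [f 0 < 0]. *)
exists s; split => //; rewrite lt_neqAle; apply/andP; split; last first.
  by move: sI; rewrite in_itv /= => /andP[].
by apply/eqP => s0; move: f0; rewrite {1}s0 fs ltxx.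
Qed.

(* Here [a] and [q] stand for [u.w] and [|w|^2]. *)
Lemma objective_gap beta eps s T t a q : 0 < s -> 0 < T ->
  beta * (s / T - 1) + 2 * eps * s = 0 ->
  beta * t + beta * a + eps / 2 * (t ^+ 2 + q) =
  beta * T + - (beta * s) + eps / 2 * (T ^+ 2 + s ^+ 2) +
  ((beta + eps * T) / T * (T * t + s * a - (T ^+ 2 - s ^+ 2)) +
   eps / 2 * ((t - T) ^+ 2 + (q + 2 * s * a + s ^+ 2))).
Proof.
move=> s0 T0 E.
(* Solving the scalar equation for [eps] turns the claim into an identity of rational functions. *)
have -> : eps = beta * (T - s) / (2 * s * T).
  have : beta * (s - T) + 2 * eps * s * T = 0.
    by rewrite -[RHS](mul0r T) -E; field; rewrite gt_eqF.
  move=> E'; apply: (mulIf (x := 2 * s * T)).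
    by rewrite !mulf_neq0 ?gt_eqF.
  rewrite divfK; first lra.
  by rewrite !mulf_neq0 ?gt_eqF.
by field; rewrite !gt_eqF.
Qed.

(** Cauchy-Schwarz in the plane for [(delta, s)] and [(delta, - a)], followed by
    [sqrt (delta^2 + a^2) <= t]. *)
Lemma support_ineq delta s t a q : 0 < delta -> 0 < s -> a ^+ 2 <= q ->
  Num.sqrt (delta ^+ 2 + q) <= t ->
  delta ^+ 2 <= Num.sqrt (delta ^+ 2 + s ^+ 2) * t + s * a.
Proof.
move=> d0 s0 aq tq.
have : delta ^+ 2 - s * a <= Num.sqrt (delta ^+ 2 + s ^+ 2) *
    Num.sqrt (delta ^+ 2 + a ^+ 2).
  rewrite -sqrtrM ?addr_ge0 ?sqr_ge0 //.
  apply: le_trans (ler_norm _) _; rewrite -sqrtr_sqr ler_wsqrtr //.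
  (* This square is [(delta^2 + s^2) (delta^2 + a^2) - (delta^2 - s a)^2]. *)
  have := sqr_ge0 (delta * (s + a)); lra.
have : Num.sqrt (delta ^+ 2 + s ^+ 2) * Num.sqrt (delta ^+ 2 + a ^+ 2) <=
    Num.sqrt (delta ^+ 2 + s ^+ 2) * t.
  rewrite ler_wpM2l ?sqrtr_ge0 //; apply: le_trans tq.
  by rewrite ler_wsqrtr // lerD2l.
lra.
Qed.

(** Multiply the scalar equation by [T (T + s)] and use [T^2 - s^2 = delta^2]. *)
Lemma stationary_scale delta beta eps s : 0 < delta ->
  stationary delta beta eps s ->
  let T := Num.sqrt (delta ^+ 2 + s ^+ 2) in
  beta * delta ^+ 2 = 2 * eps * s * T * (T + s).
Proof.
move=> d0 [s0 E] /=; have T0 := sqrt_sqrD_gt0 _ delta s d0.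
have T2 := sqr_sqrt_sqrD _ delta s.
move: (Num.sqrt _) T0 T2 E => T T0 T2 E.
have -> : delta ^+ 2 = T ^+ 2 - s ^+ 2 by rewrite T2; ring.
have : beta * (s - T) + 2 * eps * s * T = 0.
  by rewrite -[RHS](mul0r T) -E; field; rewrite gt_eqF.
by move=> E'; rewrite -[RHS]subr0 -(mul0r (T + s)) -E'; ring.
Qed.

Lemma stationary_ratio_bound delta beta eps s :
  0 < delta -> 0 < beta -> 0 < eps -> stationary delta beta eps s ->
  1 - Num.sqrt (2 * eps * delta / beta) <=
  s / Num.sqrt (delta ^+ 2 + s ^+ 2) <= 1.
Proof.
move=> d0 b0 e0 [s0 E]; have T0 := sqrt_sqrD_gt0 _ delta s d0.
have T2 := sqr_sqrt_sqrD _ delta s.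
move: (Num.sqrt (delta ^+ 2 + _)) T0 T2 E => T T0 T2 E.
set y := s / T in E *.
have sy : s = y * T by rewrite divfK ?gt_eqF.
have y0 : 0 < y by rewrite divr_gt0.
have e1 : 1 - y = 2 * eps * s / beta.
  apply: (mulIf (x := beta)); first by rewrite gt_eqF.
  by rewrite divfK ?gt_eqF //; lra.
have y1 : 0 < 1 - y by rewrite e1 divr_gt0 ?mulr_gt0.
apply/andP; split; last lra.
suff : 1 - y <= Num.sqrt (2 * eps * delta / beta) by lra.
rewrite -[1 - y]gtr0_norm // -sqrtr_sqr ler_wsqrtr //.
rewrite -ler_sqr ?nnegrE ?sqr_ge0 //; last by rewrite ltW // divr_gt0 ?mulr_gt0.
have e2 : 1 - y <= 2 * eps / beta * T.
  rewrite e1 [leLHS](_ : _ = 2 * eps / beta * s); last by ring.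
  by rewrite ler_pM2l ?divr_gt0 ?mulr_gt0 // sy ger_pMl //; lra.
have e3 : (1 - y) * (1 + y) * T ^+ 2 = delta ^+ 2.
  have -> : delta ^+ 2 = T ^+ 2 - s ^+ 2 by rewrite T2 addrK.
  by rewrite sy; ring.
(* The goal has been squared again so that [e3] can trade [delta^2] for [T^2]. It remains to compare
   factors: [1 - y <= 2 eps T / beta] by [e2], and [1 - y <= 1 + y]. *)
have -> : (2 * eps * delta / beta) ^+ 2 = (2 * eps / beta * T) ^+ 2 * ((1 - y) * (1 + y)).
  transitivity ((2 * eps / beta) ^+ 2 * delta ^+ 2); first by ring.
  by rewrite -e3; ring.
rewrite [leLHS](_ : _ = (1 - y) ^+ 2 * ((1 - y) * (1 - y))); last by ring.
apply: ler_pM; rewrite ?sqr_ge0 ?mulr_ge0 ?(ltW y1) //.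
  by rewrite ler_sqr ?nnegrE ?(ltW y1) // (le_trans (ltW y1)).
by rewrite ler_wpM2l ?(ltW y1) //; lra.
Qed.


(** * Limits from the right *)

Lemma cvg_at_right_eq {T : topologicalType} (a : R) (f g : R -> T) (l : T) :
  (forall x, a < x -> f x = g x) ->
  g x @[x --> a^'+] --> l -> f x @[x --> a^'+] --> l.
Proof.
move=> fg gl; apply: cvg_trans gl; apply: near_eq_cvg.
by near=> x; rewrite /= fg.
Unshelve. all: by end_near. Qed.

Lemma cvg_powR {T : Type} {F : set_system T} {FF : Filter F} (f : T -> R) (l p : R) :
  0 < l -> f x @[x --> F] --> l -> f x `^ p @[x --> F] --> l `^ p.
Proof.
move=> l0 fl; apply: (continuous_cvg _ (h := fun x : R => x `^ p)) => //.
apply: differentiable_continuous; apply/derivable1_diffP.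
by apply: derivable_powR; rewrite in_itv /= l0.
Qed.

(** The inverse ratio [s / T] is squeezed between 1 and a lower bound that tends to 1. *)
Lemma stationary_ratio_cvg delta beta (s : R -> R) :
  0 < delta -> 0 < beta ->
  (forall eps, 0 < eps -> stationary delta beta eps (s eps)) ->
  Num.sqrt (delta ^+ 2 + s eps ^+ 2) / s eps @[eps --> 0^'+] --> (1 : R).
Proof.
move=> d0 b0 hs.
apply: (@cvg_at_right_eq _ _ _
  (fun eps => (s eps / Num.sqrt (delta ^+ 2 + s eps ^+ 2))^-1)).
  by move=> eps _; rewrite invf_div.
suff h : s eps / Num.sqrt (delta ^+ 2 + s eps ^+ 2) @[eps --> 0^'+] --> (1 : R).
  by have := cvgV (oner_neq0 R) h; rewrite invr1; apply.
apply: (@squeeze_cvgr _ _ _ _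
  (fun eps => 1 - Num.sqrt (2 * eps * delta / beta)) (fun=> 1)).
- by near=> eps; apply: stationary_ratio_bound => //; apply: hs.
- suff h : Num.sqrt (2 * eps * delta / beta) @[eps --> 0^'+] --> (0 : R).
    by have := cvgB (cvg_cst (1 : R)) h; rewrite subr0; apply.
  have lin : continuous (fun e : R => 2 * e * delta / beta).
    move=> e; do 2 (apply: cvgM; last exact: cvg_cst).
    by apply: cvgM; [exact: cvg_cst | exact: cvg_id].
  apply: cvg_at_right_filter.
  have := cvg_comp _ _ (lin 0) (@sqrt_continuous R _).
  by rewrite mulr0 !mul0r sqrtr0; apply.
- exact: cvg_cst.
Unshelve. all: by end_near. Qed.

(** * Fractional powers *)

Lemma powR_cube_third (a : R) : 0 <= a -> (a ^+ 3) `^ (1 / 3) = a.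
Proof. by move=> a0; rewrite -powR_mulrn // -powRrM mulrC divfK ?powRr1. Qed.

Lemma powR_third_cube (a : R) : 0 <= a -> (a `^ (1 / 3)) ^+ 3 = a.
Proof. by move=> a0; rewrite -powR_mulrn ?powR_ge0 // -powRrM divfK ?powRr1. Qed.

Lemma powR_two_thirds (a : R) : a `^ (2 / 3) = (a `^ (1 / 3)) ^+ 2.
Proof. by rewrite -powR_mulrn ?powR_ge0 // -powRrM mulrAC mul1r. Qed.

(** This is the common scale of the three value asymptotics. The cube root of [K] is
    [4^(1/3) eps^(1/3) s r]; in its square the factor [4^(2/3)] cancels [2^(-4/3)], and the three
    factors [eps^(1/3)] multiply to [eps]. *)
Lemma cube_scale (K eps s r : R) : 0 < eps -> 0 < s -> 0 < r ->
  K = 4 * eps * s ^+ 3 * r ^+ 3 ->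
  2 `^ (- (4 / 3)) * K `^ (2 / 3) * eps `^ (1 / 3) = eps * s ^+ 2 * r ^+ 2.
Proof.
move=> e0 s0 r0 ->.
have c0 : 0 < eps `^ (1 / 3) by exact: powR_gt0.
have d0 : 0 < (4 : R) `^ (1 / 3) by exact: powR_gt0.
have -> : (4 * eps * s ^+ 3 * r ^+ 3) `^ (2 / 3) =
    (4 `^ (1 / 3) * eps `^ (1 / 3) * s * r) ^+ 2.
  rewrite powR_two_thirds -mulrA -exprMn powRM ?mulr_ge0 ?exprn_ge0 ?mulr_ge0 ?ltW //.
  by rewrite powR_cube_third ?mulr_ge0 ?ltW // powRM ?ltW // mulrA.
have -> : 2 `^ (- (4 / 3)) = ((4 : R) `^ (1 / 3) ^+ 2)^-1.
  rewrite powRN; congr (_^-1); rewrite -powR_two_thirds.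
  rewrite [X in _ = X `^ _](_ : 4 = (2 : R) `^ 2).
    by rewrite -powRrM; congr (_ `^ _); lra.
  by rewrite powR_mulrn // expr2; lra.
rewrite -[in RHS](powR_third_cube eps) ?ltW //.
by field; rewrite gt_eqF.
Qed.

(** Brings the constant for [ell0] to the form treated by [cube_scale]. *)
Lemma powR_two_third_shift : (2 : R) `^ (- (1 / 3)) = 2 * 2 `^ (- (4 / 3)).
Proof.
rewrite -{2}[2](@powRr1 R) // -powRD; first by congr (_ `^ _); lra.
by apply/implyP => _; rewrite pnatr_eq0.
Qed.

(** * Growth rates from the limit of a quotient *)

Lemma Theta_of_cvg {F : filter_on R} (f g : R -> R) (L : R) : 0 < L ->
  (\forall x \near F, 0 < g x) -> f x / g x @[x --> F] --> L ->
  (f : R -> R^o) =Theta_F (g : R -> R^o).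
Proof.
move=> L0 g0 fgL; rewrite eqThetaE qualifE; apply/asboolP.
(* Any two positive constants strictly on either side of [L] eventually bound the quotient. *)
exists (L / 2, L * 2) => /=; first by rewrite !(divr_gt0, mulr_gt0).
have h1 : \forall x \near F, L / 2 < f x / g x.
  by apply: (cvgr_gt _ fgL); lra.
have h2 : \forall x \near F, f x / g x < L * 2.
  by apply: (cvgr_lt _ fgL); lra.
near=> x.
have gx : 0 < g x by near: x.
have a1 : L / 2 < f x / g x by near: x.
have a2 : f x / g x < L * 2 by near: x.
move: a1 a2; rewrite ltr_pdivlMr // ltr_pdivrMr // => a1 a2.
have fx : 0 < f x by apply: lt_trans a1; rewrite mulr_gt0 ?divr_gt0.
by rewrite !gtr0_norm // !ltW.
Unshelve. all: by end_near. Qed.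

Lemma powRN_cvgy (p : R) : 0 < p -> x `^ (- p) @[x --> 0^'+] --> +oo.
Proof.
move=> p0; apply/gtr0_cvgV0; first by near=> x; exact: powR_gt0.
apply: (@cvg_at_right_eq _ _ _ (fun x => x `^ p)); last exact: powR_cvg0.
by move=> x _ /=; rewrite powRN invrK.
Unshelve. all: by end_near. Qed.

Lemma cvgy_of_ratio {F : filter_on R} (f g : R -> R) (L : R) : 0 < L ->
  (\forall x \near F, 0 < g x) -> f x / g x @[x --> F] --> L ->
  g x @[x --> F] --> +oo -> f x @[x --> F] --> +oo.
Proof.
move=> L0 g0 fgL gy.
have h1 : \forall x \near F, L / 2 < f x / g x.
  by apply: (cvgr_gt _ fgL); lra.
apply: (@ger_cvgy _ _ _ _ (fun x => L / 2 * g x)); last first.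
  by apply: gt0_cvgMry; rewrite ?divr_gt0.
near=> x.
have gx : 0 < g x by near: x.
by rewrite -ler_pdivlMr // ltW //; near: x.
Unshelve. all: by end_near. Qed.

End stationary.

(** * The regularized problem in the coordinates [w = Hhalf *m z] *)

Section cone_problem.
Context {R : realType} {n : nat}.
Variables (H Hhalf : 'M[R]_n) (delta beta : R) (b u : 'cV[R]_n).
Hypotheses (hHhalf : sym_posdef Hhalf) (hsqrt : Hhalf *m Hhalf = H).
Hypotheses (hdelta : 0 < delta) (hbeta0 : 0 < beta).
Hypothesis hbeta : beta = Num.sqrt (qform (invmx H) b).
Hypothesis hu : u = beta^-1 *: (invmx Hhalf *m b).

Let Hsym : Hhalf^T = Hhalf := hHhalf.1.
Let Hunit : Hhalf \in unitmx := sym_posdef_unitmx _ hHhalf.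

Let qformE z : qform H z = dotv (Hhalf *m z) (Hhalf *m z).
Proof. by rewrite -hsqrt qform_sqr. Qed.

Let dotvbE z : dotv b z = beta * dotv u (Hhalf *m z).
Proof.
rewrite hu dotvZl mulrA divff ?gt_eqF // mul1r -dotv_mulmx_sym //.
by rewrite mulmxA mulmxV // mul1mx.
Qed.

Let u_unit : dotv u u = 1.
Proof.
have iH : invmx H = invmx Hhalf *m invmx Hhalf.
  have HH : H \in unitmx by rewrite -hsqrt unitmx_mul Hunit.
  apply: (can_inj (mulKmx HH)); rewrite mulmxV // -hsqrt mulmxA.
  by rewrite -(mulmxA Hhalf) mulmxV // mulmx1 mulmxV.
(* Since [sqrt] vanishes on negative reals, a positive [beta] forces a positive radicand, whence
   [beta^2] is that radicand. *)
have q0 : 0 < qform (invmx H) b by rewrite -sqrtr_gt0 -hbeta.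
have iS : (invmx Hhalf)^T = invmx Hhalf by rewrite trmx_inv Hsym.
rewrite hu dotvZl dotvZr -qform_sqr // -iH mulrA -expr2 exprVn.
by rewrite [in X in X^-1]hbeta sqr_sqrtr ?mulVf ?gt_eqF // ltW.
Qed.

(** The candidate [w = - s u] carried back to the original variable [z]. *)
Let point (s : R) : R * 'cV[R]_n :=
  (Num.sqrt (delta ^+ 2 + s ^+ 2), - (s *: (invmx Hhalf *m u))).

Let Hhalf_point s : Hhalf *m (point s).2 = - s *: u.
Proof. by rewrite /= mulmxN -scalemxAr mulmxA mulmxV // mul1mx scaleNr. Qed.

Lemma ell0_point s :
  ell0 beta b (point s) = beta * (Num.sqrt (delta ^+ 2 + s ^+ 2) - s).
Proof. by rewrite /ell0 dotvbE Hhalf_point dotvZr u_unit /=; ring. Qed.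

Lemma reg_point eps s :
  reg H eps (point s) = eps / 2 * (Num.sqrt (delta ^+ 2 + s ^+ 2) ^+ 2 + s ^+ 2).
Proof.
by rewrite /reg qformE Hhalf_point dotvZr dotvZl u_unit /=; ring.
Qed.

(** This is [objective_gap] with [a = u.w] and [q = |w|^2]; because [|u| = 1], the sum
    [q + 2 s a + s^2] is [|w + s u|^2]. *)
Lemma objT_gap eps s (p : R * 'cV[R]_n) (T := (point s).1) : 0 < s ->
  beta * (s / T - 1) + 2 * eps * s = 0 ->
  objT H beta b eps p = objT H beta b eps (point s) +
  ((beta + eps * T) / T *
     (T * p.1 + s * dotv u (Hhalf *m p.2) - delta ^+ 2) +
   eps / 2 * ((p.1 - T) ^+ 2 +
     dotv (Hhalf *m p.2 + s *: u) (Hhalf *m p.2 + s *: u))).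
Proof.
move=> s0 E; have T0 : 0 < T by exact: sqrt_sqrD_gt0.
have dT : delta ^+ 2 = T ^+ 2 - s ^+ 2 by rewrite sqr_sqrt_sqrD addrK.
rewrite /objT ell0_point reg_point -[Num.sqrt _]/T /ell0 /reg dotvbE qformE.
rewrite (objective_gap beta eps s T) // dT.
rewrite !(dotvDl, dotvDr, dotvZl, dotvZr) u_unit [dotv (Hhalf *m _) u]dotvC.
ring.
Qed.

Lemma stationary_minimizer eps s : 0 < eps -> stationary delta beta eps s ->
  unique (minimizer (cone_set delta H) (objT H beta b eps)) (point s).
Proof.
move=> e0 [s0 E].
have T0 : 0 < (point s).1 by exact: sqrt_sqrD_gt0.
have supp p : cone_set delta H p -> 0 <= (beta + eps * (point s).1) / (point s).1 *
     ((point s).1 * p.1 + s * dotv u (Hhalf *m p.2) - delta ^+ 2).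
  rewrite /cone_set /= qformE => Cp; apply: mulr_ge0.
    by rewrite ltW // divr_gt0 // addr_gt0 // mulr_gt0.
  by rewrite subr_ge0; apply: support_ineq Cp => //; exact: dotv_unit_le.
have quad p : 0 <= eps / 2 * ((p.1 - (point s).1) ^+ 2 +
     dotv (Hhalf *m p.2 + s *: u) (Hhalf *m p.2 + s *: u)).
  by rewrite mulr_ge0 ?addr_ge0 ?sqr_ge0 ?dotv_ge0 // ltW // divr_gt0.
have Cs : cone_set delta H (point s).
  rewrite /cone_set /= qformE Hhalf_point dotvZl dotvZr u_unit.
  by rewrite mulr1 mulrNN -expr2.
split; first split => // p Cp.
  by rewrite (objT_gap eps s p) // lerDl addr_ge0 // supp.
move=> p [Cp /(_ _ Cs)]; rewrite (objT_gap eps s p) // gerDl => gap.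
(* For a second minimizer the gap is at most 0, so its nonnegative quadratic part vanishes; this
   alone determines [p]. *)
have : eps / 2 * ((p.1 - (point s).1) ^+ 2 +
     dotv (Hhalf *m p.2 + s *: u) (Hhalf *m p.2 + s *: u)) == 0.
  by rewrite eq_le quad andbT; have := supp p Cp; lra.
rewrite mulf_eq0 gt_eqF ?divr_gt0 //= paddr_eq0 ?sqr_ge0 ?dotv_ge0 //.
rewrite sqrf_eq0 subr_eq0 => /andP[/eqP p1 /eqP /dotv_eq0 /eqP].
rewrite addr_eq0 -scaleNr -Hhalf_point => /eqP p2.
rewrite [p]surjective_pairing [LHS]surjective_pairing p1; congr pair.
by rewrite -[LHS](mulKmx Hunit) -p2 mulKmx.
Qed.

(** Two roots yield minimizers of the same problem, so their [t] components agree; squaring and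
    positivity then identify the roots. *)
Lemma stationary_unique eps s : 0 < eps -> stationary delta beta eps s ->
  unique (stationary delta beta eps) s.
Proof.
move=> e0 hs; split=> // s' hs'.
have [_ um] := stationary_minimizer _ _ e0 hs.
have [/um[+ _] _] := stationary_minimizer _ _ e0 hs'.
move=> /(congr1 (fun x => x ^+ 2)); rewrite !sqr_sqrt_sqrD => /addrI /eqP.
by rewrite eqrXn2 ?(ltW hs.1) ?(ltW hs'.1) // => /eqP.
Qed.

(** Factoring out [s] leaves a function of [T / s], which has a limit. *)
Lemma enorm_point s : 0 < s -> enorm (point s) =
  s * Num.sqrt ((Num.sqrt (delta ^+ 2 + s ^+ 2) / s) ^+ 2 +
                dotv (invmx Hhalf *m u) (invmx Hhalf *m u)).
Proof.
move=> s0; rewrite -[X in X * _](gtr0_norm s0) -sqrtr_sqr -sqrtrM ?sqr_ge0 //.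
rewrite /enorm /= -scaleNr dotvZl dotvZr; congr Num.sqrt.
by field; rewrite gt_eqF.
Qed.

End cone_problem.

(** * Minimizers and their asymptotics for small [eps] *)

Theorem theorem8p4 (R : realType) (n : nat) (H Hhalf : 'M[R]_n)
    (delta beta : R) (b u : 'cV[R]_n)
    (hn : (1 <= n)%N)
    (hH : sym_posdef H)
    (hHhalf : sym_posdef Hhalf) (hsqrt : Hhalf *m Hhalf = H)
    (hdelta : 0 < delta)
    (hbeta : beta = Num.sqrt (qform (invmx H) b)) (hbeta0 : 0 < beta)
    (hu : u = beta^-1 *: (invmx Hhalf *m b)) :
  exists (t : R -> R) (z : R -> 'cV[R]_n) (s : R -> R),
    (forall eps : R, 0 < eps ->
      [/\ unique (minimizer (cone_set delta H) (objT H beta b eps))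
                 (t eps, z eps),
          unique (fun sigma : R => 0 < sigma /\
                    beta * (sigma / Num.sqrt (delta ^+ 2 + sigma ^+ 2) - 1)
                      + 2 * eps * sigma = 0)
                 (s eps),
          t eps = Num.sqrt (delta ^+ 2 + s eps ^+ 2) &
          z eps = - (s eps *: (invmx Hhalf *m u))]) /\
    asymp s (fun eps => (beta * delta ^+ 2 / (4 * eps)) `^ (1 / 3)) /\
    asymp (fun eps => ell0 beta b (t eps, z eps))
          (fun eps => 2 `^ (- (1 / 3)) * (beta * delta ^+ 2) `^ (2 / 3)
                        * eps `^ (1 / 3)) /\
    asymp (fun eps => reg H eps (t eps, z eps))
          (fun eps => 2 `^ (- (4 / 3)) * (beta * delta ^+ 2) `^ (2 / 3)
                        * eps `^ (1 / 3)) /\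
    asymp (fun eps => optval (cone_set delta H) (objT H beta b eps))
          (fun eps => 3 * 2 `^ (- (4 / 3)) * (beta * delta ^+ 2) `^ (2 / 3)
                        * eps `^ (1 / 3)) /\
    (enorm (t eps, z eps) @[eps --> (0:R)^'+] --> +oo) /\
    ((fun eps => enorm (t eps, z eps) : R^o) =Theta_((0:R)^'+)
      (fun eps => eps `^ (- (1 / 3)) : R^o)).

Proof.
have [s hs] : exists s : R -> R, forall eps, 0 < eps -> stationary delta beta eps (s eps).
  have [|s hs] := @choice _ _ (fun eps sigma => 0 < eps -> stationary delta beta eps sigma).
    (* For [eps <= 0] the value 0 is a dummy, which limits from the right at 0 do not see. *)
    move=> eps; have [e0|] := boolP (0 < eps); last by exists 0.
    by have [x ?] := stationary_exists _ _ _ hdelta hbeta0 e0; exists x.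
  by exists s.
pose T eps := Num.sqrt (delta ^+ 2 + s eps ^+ 2).
pose x eps := T eps / s eps.
pose r eps := (x eps * (x eps + 1) / 2) `^ (1 / 3).
have T0 eps : 0 < T eps by exact: sqrt_sqrD_gt0.
have s0 eps : 0 < eps -> 0 < s eps by move=> /hs[].
have x0 eps : 0 < eps -> 0 < x eps by move=> e0; rewrite divr_gt0 ?s0.
have c0 eps : 0 < eps -> 0 < x eps * (x eps + 1) / 2.
  by move=> e0; rewrite divr_gt0 // mulr_gt0 ?addr_gt0 ?x0.
have r0 eps : 0 < eps -> 0 < r eps by move=> e0; rewrite powR_gt0 ?c0.
have Tx eps : 0 < eps -> T eps = x eps * s eps.
  by move=> e0; rewrite divfK // gt_eqF ?s0.
have x1 : x eps @[eps --> 0^'+] --> (1 : R).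
  exact: (stationary_ratio_cvg delta beta).
have r1 : r eps @[eps --> 0^'+] --> (1 : R).
  have h : x eps * (x eps + 1) / 2 @[eps --> 0^'+] --> (1 : R).
    have := cvgM (cvgM x1 (cvgD x1 (cvg_cst (1 : R)))) (cvg_cst (2^-1 : R)).
    by rewrite mul1r divff //; apply.
  by have := cvg_powR _ _ (1 / 3) ltr01 h; rewrite powR1; apply.
have scale eps : 0 < eps ->
    beta * delta ^+ 2 = 4 * eps * s eps ^+ 3 * r eps ^+ 3.
  move=> e0; rewrite (stationary_scale _ _ _ _ hdelta (hs _ e0)) -/(T eps).
  by rewrite powR_third_cube ?(ltW (c0 _ e0)) // (Tx _ e0); field.
have scale4 eps : 0 < eps -> 2 `^ (- (4 / 3)) * (beta * delta ^+ 2) `^ (2 / 3)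
    * eps `^ (1 / 3) = eps * s eps ^+ 2 * r eps ^+ 2.
  by move=> e0; apply: cube_scale (scale _ e0) => //; [exact: s0|exact: r0].
have sE eps : 0 < eps -> (beta * delta ^+ 2 / (4 * eps)) `^ (1 / 3) = s eps * r eps.
  move=> e0; rewrite (scale _ e0).
  rewrite [X in X `^ _](_ : _ = (s eps * r eps) ^+ 3); last by field; rewrite gt_eqF.
  by rewrite powR_cube_third // mulr_ge0 // ltW ?s0 ?r0.
have ellE eps : 0 < eps ->
    ell0 beta b (T eps, - (s eps *: (invmx Hhalf *m u))) = 2 * eps * s eps * T eps.
  move=> e0; have -> := ell0_point H Hhalf delta beta b u hHhalf hsqrt hbeta0 hbeta hu (s eps).
  have := stationary_scale _ _ _ _ hdelta (hs _ e0); rewrite -/(T eps) => E.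
  (* After multiplication by [T + s] both sides equal [beta delta^2], the left one through
     [T^2 - s^2 = delta^2]. *)
  apply: (mulIf (x := T eps + s eps)); first by rewrite gt_eqF ?addr_gt0 ?s0.
  by rewrite -E -(addrK (s eps ^+ 2) (delta ^+ 2)) -sqr_sqrt_sqrD -/(T eps); ring.
have regE eps : reg H eps (T eps, - (s eps *: (invmx Hhalf *m u))) =
    eps / 2 * (T eps ^+ 2 + s eps ^+ 2).
  exact: (reg_point H Hhalf delta beta b u hHhalf hsqrt hbeta0 hbeta hu).
have min eps : 0 < eps -> unique (minimizer (cone_set delta H) (objT H beta b eps))
    (T eps, - (s eps *: (invmx Hhalf *m u))).
  move=> e0; exact: (stationary_minimizer H Hhalf delta beta b u hHhalf hsqrt hdelta
    hbeta0 hbeta hu _ _ e0 (hs _ e0)).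
have r2 : r eps ^+ 2 @[eps --> 0^'+] --> (1 : R).
  by have := cvgM r1 r1; rewrite mulr1; apply.
have x2 : x eps ^+ 2 @[eps --> 0^'+] --> (1 : R).
  by have := cvgM x1 x1; rewrite mulr1; apply.
(* [q1] and [q2] are the limits of the quotients for [ell0] and for [reg]. *)
have q1 : x eps / r eps ^+ 2 @[eps --> 0^'+] --> (1 : R).
  by have := cvgM x1 (cvgV (oner_neq0 R) r2); rewrite divr1; apply.
have q2 : (x eps ^+ 2 + 1) / 2 / r eps ^+ 2 @[eps --> 0^'+] --> (1 : R).
  have := cvgM (cvgM (cvgD x2 (cvg_cst (1 : R))) (cvg_cst (2^-1 : R)))
    (cvgV (oner_neq0 R) r2).
  by rewrite divff // divr1; apply.
(* [k] is the constant in [s ~ k eps^(-1/3)], and [kappa] below is the squared norm of [z / s];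
   hence the limit [k sqrt (1 + kappa)] for the norm. *)
pose k := (beta * delta ^+ 2 / 4) `^ (1 / 3).
have K0 : 0 < beta * delta ^+ 2 by rewrite mulr_gt0 ?exprn_gt0.
have k0 : 0 < k by rewrite powR_gt0 // divr_gt0.
pose kappa := dotv (invmx Hhalf *m u) (invmx Hhalf *m u).
have L0 : 0 < k * Num.sqrt (1 + kappa).
  by rewrite mulr_gt0 // sqrtr_gt0 ltr_pwDl ?dotv_ge0.
have g0 : \forall eps \near 0^'+, 0 < eps `^ (- (1 / 3)) :> R.
  by near=> eps; exact: powR_gt0.
have enormL : enorm (T eps, - (s eps *: (invmx Hhalf *m u))) / eps `^ (- (1 / 3))
    @[eps --> 0^'+] --> k * Num.sqrt (1 + kappa).
  apply: (@cvg_at_right_eq _ _ _ _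
    (fun eps => k * Num.sqrt (x eps ^+ 2 + kappa) / r eps)).
    (* Splitting the power in [sE] gives [k eps^(-1/3) = s r], which eliminates [s] from the
       quotient. *)
    move=> eps e0; have := sE _ e0.
    rewrite invfM mulrA powRM ?invr_ge0 ?ltW ?divr_gt0 // -/k.
    rewrite -(powR_inv1 (ltW e0)) -powRrM mulN1r powRN => kE.
    rewrite (enorm_point Hhalf delta u _ (s0 _ e0)) -/(T eps) -/(x eps) -/kappa.
    have -> : k = s eps * r eps * eps `^ (1 / 3).
      by rewrite -kE mulfVK // gt_eqF // powR_gt0.
    by field; rewrite !gt_eqF ?s0 ?r0 ?powR_gt0.
  have sq : Num.sqrt (x eps ^+ 2 + kappa) @[eps --> 0^'+] --> Num.sqrt (1 + kappa).
    apply: (cvg_comp (fun eps => x eps ^+ 2 + kappa) Num.sqrt); last first.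
      exact: sqrt_continuous.
    exact: cvgD x2 (cvg_cst kappa).
  have := cvgM (cvgM (cvg_cst k) sq) (cvgV (oner_neq0 R) r1).
  by rewrite invr1 mulr1; apply.
exists T, (fun eps => - (s eps *: (invmx Hhalf *m u))), s.
split.
  move=> eps e0; split => //; first exact: min.
  exact: (stationary_unique H Hhalf delta beta b u hHhalf hsqrt hdelta
    hbeta0 hbeta hu _ _ e0 (hs _ e0)).
split.
  apply: (@cvg_at_right_eq _ _ _ _ (fun eps => (r eps)^-1)).
    move=> eps e0; rewrite sE //; field.
    by rewrite !gt_eqF ?s0 ?r0.
  by have := cvgV (oner_neq0 R) r1; rewrite invr1; apply.
split.
  apply: (@cvg_at_right_eq _ _ _ _ (fun eps => x eps / r eps ^+ 2)) => //.
  move=> eps e0; rewrite ellE // powR_two_third_shift -!mulrA [2 `^ _ * _]mulrA scale4 //.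
  rewrite Tx //; field.
  by rewrite !gt_eqF ?s0 ?r0.
split.
  apply: (@cvg_at_right_eq _ _ _ _ (fun eps => (x eps ^+ 2 + 1) / 2 / r eps ^+ 2)) => //.
  move=> eps e0; rewrite regE scale4 // Tx //; field.
  by rewrite !gt_eqF ?s0 ?r0.
split.
  (* The weights are the shares of the two terms in the value: in units of the common scale, [ell0]
     contributes 2 and [reg] contributes 1 out of 3. *)
  apply: (@cvg_at_right_eq _ _ _ _ (fun eps => 2 / 3 * (x eps / r eps ^+ 2) +
    1 / 3 * ((x eps ^+ 2 + 1) / 2 / r eps ^+ 2))).
    move=> eps e0; rewrite (minimizer_optval _ _ _ _ _ (min _ e0).1) /objT ellE // regE.
    rewrite -!mulrA [2 `^ _ * _]mulrA scale4 //.
    by rewrite Tx //; field; rewrite !gt_eqF ?s0 ?r0.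
  have := cvgD (cvgM (cvg_cst (2 / 3 : R)) q1) (cvgM (cvg_cst (1 / 3 : R)) q2).
  by rewrite !mulr1 (_ : 2 / 3 + 1 / 3 = 1); [apply | lra].
split.
  by apply: (cvgy_of_ratio _ _ _ L0 g0 enormL); apply: powRN_cvgy; lra.
exact: (Theta_of_cvg _ _ _ L0 g0 enormL).
Unshelve. all: by end_near. Qed.
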